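(* For all $n\ge3$, $d_n(231)<F_n$.
   Context: $d_n(231)$ is the number of permutations $\pi=\pi_1\cdots\pi_n$ of $\{1,\dots,n\}$ with no fixed points ($\pi_i\ne i$ for all $i$) that avoid $231$ (no indices $i<j<k$ with $\pi_k<\pi_i<\pi_j$). The Fine numbers are $F_n=\sum_{1\le k\le n/2}\left[\binom{2n-2k-1}{n-1}-\binom{2n-2k-1}{n}\right]$ for $n\ge1$, so $F_1=0,F_2=1,F_3=2,F_4=6,F_5=18,\dots$. *)

(* Defs.v *)
From mathcomp Require Import all_boot all_order all_fingroup all_algebra.

Set Implicit Arguments.
Unset Strict Implicit.
Unset Printing Implicit Defensive.

(* Permutations act on 'I_n = {0, ..., n-1} instead of {1, ..., n}; shifting
   positions and values simultaneously by one preserves both fixed points and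
   the relative order of entries. *)

Definition derangement (n : nat) (s : 'S_n) : bool :=
  [forall i : 'I_n, s i != i].

Definition avoids231 (n : nat) (s : 'S_n) : bool :=
  ~~ [exists i : 'I_n, exists j : 'I_n, exists k : 'I_n,
        [&& i < j, j < k, s k < s i & s i < s j]].

Definition d231 (n : nat) : nat :=
  #|[set s : 'S_n | derangement s && avoids231 s]|.

(* The differences of binomials are taken in int.  The upper index
   2n - 2k - 1 is a natural number subtraction, but it is never truncated:
   2k <= n and n >= 1 give 2n - 2k - 1 >= n - 1. *)
Definition fine (n : nat) : int :=
  (\sum_(1 <= k < n./2.+1)
     ('C(2 * n - 2 * k - 1, n - 1)%:Z - 'C(2 * n - 2 * k - 1, n)%:Z))%R.

(* Main.v *)
(* Encode a permutation [s] by the word [d] in which [d_i] is the number of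
   positions [j < i] with [s j > s i]; this encoding is injective.  If [s]
   avoids 231 then [d_0 = 0] and [d_{i+1} <= d_i + 1], so [d] lists the depths
   of the nodes of a plane forest in preorder.  A root without children is a
   position with only smaller entries before it and only larger ones after it,
   hence a fixed point; so the code of a 231-avoiding derangement is a forest
   without isolated roots.  The number of ways to complete such a word satisfies
   the same recurrence as the coefficients of [C^(h+1) F], where [h > 0] is the
   current depth, [C] is the Catalan and [F] the Fine generating function.
   The inequality is strict because the forest [0 1 2 1 ... 1] is the code of
   [n 2 1 3 ... n-1], which fixes 2. *)

Require Import Defs.
From mathcomp Require Import all_boot all_order all_fingroup all_algebra.
From mathcomp Require Import zify ring.

Set Implicit Arguments.
Unset Strict Implicit.
Unset Printing Implicit Defensive.

(** * Left inversion codes *)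

Definition left_inv n (s : 'S_n) (i : 'I_n) : nat :=
  #|[set j : 'I_n | (j < i) && (s i < s j)]|.

Definition left_code n (s : 'S_n) : seq nat := map (left_inv s) (enum 'I_n).

Lemma size_left_code n (s : 'S_n) : size (left_code s) = n.
Proof. by rewrite size_map size_enum_ord. Qed.

Lemma nth_left_code n (s : 'S_n) (i : 'I_n) :
  nth 0 (left_code s) i = left_inv s i.
Proof. by rewrite (nth_map i) ?size_enum_ord // nth_ord_enum. Qed.

Lemma left_invE n (s : 'S_n) (i : 'I_n) :
  left_inv s i = #|[set v : 'I_n | (s^-1%g v <= i) && (s i < v)]|.
Proof.
rewrite -(card_preimset _ (@perm_inj _ s)); apply: eq_card => j.
rewrite !inE permK; case: ltngtP => // /val_inj ->.
by rewrite ltnn.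
Qed.

(** Entries are recovered from right to left: the later entries fix the set of values still to be
    placed, and the code gives the rank of the next entry in that set. *)
Lemma left_code_inj n : injective (@left_code n).
Proof.
move=> s t eq_st; apply/permP => i.
have eqd j : left_inv s j = left_inv t j by rewrite -!nth_left_code eq_st.
have [m] := ubnP (n - i); elim: m i => // m IHm i lt_m.
have IH (j : 'I_n) : i < j -> s j = t j.
  by move=> ij; apply: IHm; have := ltn_ord j; lia.
clear IHm lt_m.
wlog lt_st : s t {eq_st} eqd IH / s i < t i.
  move=> W; case: (ltngtP (s i) (t i)) => [|lt_ts|/val_inj //]; first exact: W.
  by apply/esym; apply: W lt_ts => // j /IH.
suff: left_inv t i < left_inv s i by rewrite eqd ltnn.
(* [s] and [t] take the same values at the positions up to [i], and both
   [left_inv s i] and [left_inv t i] count such values. *)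
have same_values v : (t^-1%g v <= i) -> (s^-1%g v <= i).
  apply: contraTT; rewrite -!ltnNge => lt_i.
  by have := IH _ lt_i; rewrite permKV => ->; rewrite permK.
rewrite !left_invE; apply/proper_card/properP; split.
  apply/subsetP => v; rewrite !inE.
  by case/andP=> /same_values-> /(ltn_trans lt_st)->.
exists (t i); rewrite !inE ?ltnn ?andbF // lt_st andbT.
by apply: same_values; rewrite permK.
Qed.

Lemma perm_val_card n (s : 'S_n) (i : 'I_n) :
  s i = #|[set j : 'I_n | s j < s i]| :> nat.
Proof.
rewrite [RHS](_ : _ = #|s @^-1: [set v : 'I_n | v < s i]|); last first.
  by apply: eq_card => j; rewrite !inE.
rewrite (card_preimset _ perm_inj) -sum1_card.
rewrite (eq_bigl (fun v : 'I_n => v < s i)); last by move=> v; rewrite inE.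
by rewrite -(big_ord_widen _ (fun=> 1)) ?sum1_card ?card_ord // ltnW.
Qed.

(** * Codes of 231-avoiding permutations and derangements *)

Section Avoid231.
Variables (n : nat) (s : 'S_n).
Hypothesis s_avoids : avoids231 s.

Lemma avoids231P (i j k : 'I_n) : i < j -> j < k -> s i < s j -> s i < s k.
Proof.
move=> ij jk sij; rewrite ltnNge leq_eqVlt; apply/negP => /orP[/eqP/val_inj/perm_inj|].
  by move=> E; move: ij; rewrite -E ltnNge ltnW.
move=> ski; move/negP: s_avoids; apply.
apply/existsP; exists i; apply/existsP; exists j; apply/existsP; exists k.
exact/and4P.
Qed.

(** An entry before [i] that exceeds [s j] but not [s i] would form a 231 with [s i] and [s j]; so
    only [i] itself can be a new inversion. *)
Lemma left_inv_succ (i j : 'I_n) :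
  j = i.+1 :> nat -> left_inv s j <= (left_inv s i).+1.
Proof.
move=> ji; apply: (@leq_trans #|i |: [set k : 'I_n | (k < i) && (s i < s k)]|); last first.
  by rewrite cardsU1; case: (_ \notin _); rewrite ?add0n.
apply/subset_leq_card/subsetP => k; rewrite !inE ji ltnS leq_eqVlt.
case/andP => /orP[/eqP/val_inj-> | ki] sjk; first by rewrite eqxx.
rewrite ki /=; apply/orP; right; rewrite ltnNge leq_eqVlt; apply/negP.
case/orP => [/eqP/val_inj/perm_inj E | ski]; first by move: ki; rewrite E ltnn.
by have := avoids231P ki _ ski; move=> /(_ j); rewrite ji ltnS leqnn => /(_ isT); lia.
Qed.

Lemma left_inv0P (i j : 'I_n) : left_inv s i = 0 -> j < i -> s j < s i.
Proof.
move/eqP; rewrite cards_eq0 => /eqP/setP/(_ j); rewrite !inE => + ji.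
rewrite ji /= => /negbT; rewrite -leqNgt leq_eqVlt => /orP[/eqP/val_inj/perm_inj E|//].
by move: ji; rewrite E ltnn.
Qed.

(** The values below [s i] sit exactly at the positions before [i]. *)
Lemma left_inv0_fixed (i : 'I_n) :
  left_inv s i = 0 -> (forall j : 'I_n, i < j -> s i < s j) -> s i = i.
Proof.
move=> di right_i; apply/val_inj; rewrite /= perm_val_card -[RHS]card_ord.
rewrite -!sum1_card (eq_bigl (fun j : 'I_n => j < i)); last first.
  move=> j; rewrite inE; case: (ltngtP j i) => [ji|/right_i|/val_inj->].
  - exact: left_inv0P.
  - by move=> ?; apply/negbTE; lia.
  - by rewrite ltnn.
by rewrite -(big_ord_widen _ (fun=> 1)) // ltnW.
Qed.

End Avoid231.

(* Depths of consecutive nodes, in preorder, of a plane forest without isolated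
   roots. *)
Definition fine_step (h h' : nat) : bool := if h == 0 then h' == 1 else h' <= h.+1.

(** A word ending at depth 0 is rejected: its last node would be a childless root. *)
Fixpoint fine_paths (m h : nat) : seq (seq nat) :=
  if m is m'.+1 then
    [seq h' :: p | h' <- if h == 0 then [:: 1] else iota 0 h.+2, p <- fine_paths m' h']
  else if h == 0 then [::] else [:: [::]].

Lemma mem_fine_paths m h p : size p = m -> path fine_step h p -> last h p != 0 ->
  p \in fine_paths m h.
Proof.
elim: p m h => [|h' p IHp] [|m] h //=; first by move=> _ _ /negbTE->.
case=> szp /andP[hh' pp] lp; apply/allpairsPdep; exists h', p.
split=> //; last exact: IHp.
move: hh'; rewrite /fine_step; case: (h == 0) => hh'; first by rewrite inE.
by rewrite -[0 :: _]/(iota 0 h.+2) mem_iota.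
Qed.

Lemma left_code_fine n (s : 'S_n.+1) : derangement s -> avoids231 s ->
  left_code s \in map (cons 0) (fine_paths n 0).
Proof.
move=> /forallP s_der s_avoids.
have left0 : nth 0 (left_code s) 0 = 0.
  rewrite (nth_left_code s ord0); apply/eqP; rewrite cards_eq0.
  by apply/eqP/setP => j; rewrite !inE.
have szs := size_left_code s.
have srt : sorted fine_step (left_code s).
  apply/(sortedP 0) => i; rewrite szs => lti.
  have := nth_left_code s (Ordinal lti); have := nth_left_code s (Ordinal (ltnW lti)).
  set i0 := Ordinal _; set i1 := Ordinal lti; rewrite /= => -> ->.
  have i01 : i0 < i1 by [].
  have step : left_inv s i1 <= (left_inv s i0).+1 by exact: left_inv_succ.
  (* Two consecutive zeros give [s i0 < s i1]; avoiding 231 then keeps all later entries above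
     [s i0], so [i0] would be fixed. *)
  rewrite /fine_step; case: eqP => // d0; rewrite eqn_leq -{1}d0 step /= lt0n.
  apply/negP => /eqP d1; case/eqP: (s_der i0); apply: left_inv0_fixed => // j.
  have lt01 := left_inv0P d1 i01.
  rewrite leq_eqVlt => /orP[/eqP j1|]; last by move=> i1j; apply: avoids231P lt01.
  by rewrite (_ : j = i1) //; apply/val_inj.
have lasts : last 0 (left_code s) != 0.
  rewrite (_ : last _ _ = left_inv s ord_max); last first.
    by rewrite -nth_last szs -nth_left_code.
  apply/eqP => dn; case/eqP: (s_der ord_max).
  by apply: left_inv0_fixed => // j; rewrite ltnNge -ltnS ltn_ord.
case: (left_code s) left0 szs srt lasts => //= a p -> [szp] srt lasts.
by apply: map_f; apply: mem_fine_paths.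
Qed.

(** The code forces [s i2 < s i1 < s ord0]. A later entry below [s i1] would have two inversions, so
    [s i2] is the only value below [s i1], and [i1] is fixed. *)
Lemma left_code_neq012 k (s : 'S_k.+3) :
  derangement s -> left_code s <> [:: 0, 1, 2 & nseq k 1].
Proof.
move=> /forallP s_der code_s.
pose i1 : 'I_k.+3 := inord 1; pose i2 : 'I_k.+3 := inord 2.
have i1E : i1 = 1 :> nat by rewrite inordK.
have i2E : i2 = 2 :> nat by rewrite inordK.
have d1 : left_inv s i1 = 1 by rewrite -nth_left_code code_s i1E.
have d2 : left_inv s i2 = 2 by rewrite -nth_left_code code_s i2E.
have dj (j : 'I_k.+3) : 2 < j -> left_inv s j = 1.
  move=> j2; rewrite -nth_left_code code_s; have := ltn_ord j.
  by case: (j : nat) j2 => [|[|[|m]]] //= _ mk; rewrite nth_nseq ifT.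
have s10 : s i1 < s ord0.
  have /card_gt0P[j] : 0 < left_inv s i1 by rewrite d1.
  rewrite inE i1E ltnS leqn0 => /andP[/eqP j0].
  by rewrite (_ : j = ord0) //; apply/val_inj.
have s21 : s i2 < s i1.
  rewrite ltnNge; apply/negP => s12.
  suff: left_inv s i2 <= #|[set (ord0 : 'I_k.+3)]| by rewrite cards1 d2.
  apply/subset_leq_card/subsetP => j; rewrite !inE i2E => /andP[j2 sj].
  rewrite -val_eqE /=; case: (posnP j) => [_ //|j0].
  have ji1 : j = i1 :> nat by lia.
  by move: sj; rewrite (val_inj ji1) ltnNge s12.
have s1j (j : 'I_k.+3) : 2 < j -> s i1 <= s j.
  move=> j2; rewrite leqNgt; apply/negP => sj.
  suff: #|[set ord0; i1]| <= left_inv s j by rewrite cards2 dj // -val_eqE /= i1E.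
  apply/subset_leq_card/subsetP => v; rewrite !inE => /orP[]/eqP->.
    by rewrite (ltn_trans sj s10) andbT (leq_trans _ j2).
  by rewrite sj i1E; lia.
case/eqP: (s_der i1); apply/val_inj; rewrite /= perm_val_card i1E -(cards1 i2).
apply: eq_card => j; rewrite !inE -val_eqE /= i2E.
case: (ltngtP j 2) => [j2|/s1j|j2].
- apply/negbTE; rewrite -leqNgt; case: (posnP j) => j0.
    by rewrite (_ : j = ord0) ?(ltnW s10) //; apply/val_inj.
  by rewrite (_ : j = i1) //; apply/val_inj; rewrite /= i1E; lia.
- by rewrite leqNgt => /negbTE.
- by rewrite (_ : j = i2) //; apply/val_inj; rewrite /= i2E.
Qed.

Lemma d231_lt n : 3 <= n -> d231 n < size (fine_paths n.-1 0).
Proof.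
case: n => [|[|[|k]]] // _; rewrite -(size_map (cons 0)) /d231 cardE.
set D := [set _ | _]; pose x := [:: 0, 1, 2 & nseq k 1].
(* Strictness: the codes together with the extra word [x] are still pairwise distinct. *)
rewrite -(size_map (@left_code _)) -[_.+1]/(size (x :: _)).
apply: uniq_leq_size.
  rewrite cons_uniq map_inj_uniq ?enum_uniq ?andbT; last exact: left_code_inj.
  apply/mapP => -[s]; rewrite mem_enum inE => /andP[s_der _] /esym.
  exact: left_code_neq012.
move=> c; rewrite inE => /orP[/eqP->|/mapP[s]]; last first.
  by rewrite mem_enum inE => /andP[s_der s_av] ->; apply: left_code_fine.
apply: map_f; apply: mem_fine_paths; rewrite /= ?size_nseq //.
  by case: k {D x} => //= k; elim: k.
by case: k {D x} => //= k; elim: k.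
Qed.

(** * Coefficients of Catalan powers and of the Fine series *)

Import GRing.Theory.
Local Open Scope ring_scope.

(* The coefficient of [x^n] in [C^k], where [C] is the generating function of
   the Catalan numbers (except that the value at [n = k = 0] is [0]). *)
Definition ballot (n k : nat) : int :=
  'C(n.*2 + k - 1, n + k - 1)%:Z - 'C(n.*2 + k - 1, n + k)%:Z.

(** Pascal's rule; in series, C = 1 + x C^2 multiplied by C^k. *)
Lemma ballotSS n k : ballot n.+1 k.+1 = ballot n.+1 k + ballot n k.+2.
Proof.
rewrite /ballot.
rewrite (_ : n.+1.*2 + k.+1 - 1 = (n.*2 + k.+1).+1)%N; last lia.
rewrite (_ : n.+1.*2 + k - 1 = n.*2 + k.+1)%N; last lia.
rewrite (_ : n.*2 + k.+2 - 1 = n.*2 + k.+1)%N; last lia.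
rewrite (_ : n.+1 + k.+1 - 1 = (n + k).+1)%N; last lia.
rewrite (_ : n.+1 + k.+1 = (n + k).+2)%N; last lia.
rewrite (_ : n.+1 + k - 1 = n + k)%N; last lia.
rewrite (_ : n.+1 + k = (n + k).+1)%N; last lia.
rewrite (_ : n + k.+2 - 1 = (n + k).+1)%N; last lia.
rewrite (_ : n + k.+2 = (n + k).+2)%N; last lia.
by rewrite !binS !PoszD; ring.
Qed.

Lemma ballot0S k : ballot 0 k.+1 = 1.
Proof. by rewrite /ballot double0 !add0n subn1 binn bin_small. Qed.

Lemma ballotS0 n : ballot n.+1 0 = 0.
Proof.
rewrite /ballot !addn0 -(@bin_sub _ n.+1); last lia.
by rewrite (_ : (n.+1.*2 - 1 - n.+1 = n.+1 - 1)%N) ?subrr //; lia.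
Qed.

(* The coefficient of [x^n] in [C^k F], where [F = 1 / (1 - x^2 C^2)] is the
   generating function of the Fine numbers (again except at [n = k = 0]). *)
Fixpoint fine_conv (n k : nat) : int :=
  match n with
  | 0 => ballot 0 k
  | 1 => ballot 1 k
  | n'.+2 => ballot n k + fine_conv n' k.+2
  end.

(** The relation of [ballotSS] multiplied by F. *)
Lemma fine_conv_SS n k : fine_conv n.+1 k.+1 = fine_conv n.+1 k + fine_conv n k.+2.
Proof.
elim/ltn_ind: n k => -[|[|n]] IHn k.
- exact: ballotSS.
- by rewrite /= ballotSS !ballot0S; ring.
- rewrite -[fine_conv n.+3 k.+1]/(ballot n.+3 k.+1 + fine_conv n.+1 k.+3).
  rewrite -[fine_conv n.+3 k]/(ballot n.+3 k + fine_conv n.+1 k.+2).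
  by rewrite IHn // ballotSS [fine_conv n.+2 _]/=; ring.
Qed.

(** Geometric expansion of 1 / (1 - x^2 C^2). *)
Lemma fine_convE n k :
  fine_conv n k = \sum_(0 <= j < n./2.+1) ballot (n - j.*2) (k + j.*2).
Proof.
elim/ltn_ind: n k => -[|[|n]] IHn k; try by rewrite big_nat1 subn0 addn0.
rewrite big_nat_recl // subn0 addn0 [LHS]/= IHn //; congr (_ + _).
by apply: eq_bigr => j _; congr ballot; lia.
Qed.

(** In series, F = 1 + x^2 C^2 F. *)
Lemma fine_conv_fine n : fine n.+2 = fine_conv n 2.
Proof.
rewrite /fine fine_convE big_add1 /= !big_nat; apply: eq_bigr => j /andP[_ lt_j].
have le_j : (j.*2 <= n)%N by rewrite -[n]odd_double_half; lia.
rewrite /ballot.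
rewrite (_ : 2 * n.+2 - 2 * j.+1 - 1 = (n - j.*2).*2 + (2 + j.*2) - 1)%N; last lia.
rewrite (_ : n.+2 - 1 = n - j.*2 + (2 + j.*2) - 1)%N; last lia.
by rewrite (_ : n.+2 = n - j.*2 + (2 + j.*2))%N; last lia.
Qed.

(** * Counting the words *)

Definition num_paths m h : int := (size (fine_paths m h))%:Z.

Lemma num_pathsS0 m : num_paths m.+1 0 = num_paths m 1.
Proof. by rewrite /num_paths /= cats0 size_map. Qed.

Lemma num_pathsS m h : num_paths m.+1 h.+1 = \sum_(0 <= i < h.+3) num_paths m i.
Proof.
have size_paths : size (fine_paths m.+1 h.+1) =
    sumn [seq size (fine_paths m i) | i <- iota 0 h.+3].
  exact: size_allpairs_dep.
rewrite /num_paths size_paths sumnE big_map -/(index_iota 0 h.+3).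
by elim/big_rec2: _ => //= i x y _ <-.
Qed.

Lemma num_pathsSS m h :
  num_paths m.+1 h.+2 = num_paths m.+1 h.+1 + num_paths m h.+3.
Proof. by rewrite !num_pathsS big_nat_recr. Qed.

Lemma num_paths_fine m h : num_paths m h.+1 = fine_conv m h.+2.
Proof.
(* Depth 0 is needed in the induction, with its exponent shifted by one: it yields the coefficient
   of x^(m+1) in F. *)
suff: num_paths m 0 = fine_conv m.+1 0 /\
      forall h, num_paths m h.+1 = fine_conv m h.+2 by case.
elim: m {h} => [|m [IH0 IHm]].
  by rewrite /= ballotS0; split=> // h; rewrite ballot0S.
split.
  rewrite num_pathsS0 IHm -[RHS]/(ballot m.+2 0 + fine_conv m 2).
  by rewrite ballotS0 add0r.
elim=> [|h IHh]; last by rewrite num_pathsSS IHh IHm -fine_conv_SS.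
(* From depth 1 the next depth is 0, 1 or 2, and F + x C^2 F + x C^3 F = C F + x C^3 F = C^2 F in
   degree m+1. *)
rewrite num_pathsS !big_nat_recr //= big_nil add0r IH0 !IHm.
by rewrite -!fine_conv_SS.
Qed.

Local Close Scope ring_scope.

Theorem theorem7p1 (n : nat) (hn : 3 <= n) : ((d231 n)%:Z < fine n)%R.
Proof.
case: n hn => [|[|n]] // hn.
rewrite fine_conv_fine -(num_paths_fine n 0) -num_pathsS0 ltz_nat.
exact: d231_lt.
Qed.
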